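(* Let $\mathbb{K}$ be a field of characteristic zero and let $\mathcal{S}_2$ be the algebra of all commutative $2$-dimensional algebras with trace zero multiplication over $\mathbb{K}$. Every local $\frac12$-derivation of $\mathcal{S}_2$ is a $\frac12$-derivation of $\mathcal{S}_2$.
   Context: Algebras are vector spaces over $\mathbb{K}$ with a bilinear multiplication; they need not be associative, commutative or unital. The algebra $\mathcal{S}_2$ is the $4$-dimensional algebra over $\mathbb{K}$ with basis $z_1,z_2,z_3,z_4$ and the following multiplication (left factor first; all products of basis elements not listed are $0$): $z_1z_1=-z_1$, $z_1z_2=z_2$, $z_1z_3=3z_3$, $z_1z_4=-3z_4$; $z_2z_1=-2z_2$, $z_2z_2=-3z_3$, $z_2z_4=z_1$; $z_4z_1=3z_4$, $z_4z_2=-2z_1$, $z_4z_3=-z_2$. A linear map $d:\mathcal{A}\to\mathcal{A}$ on an algebra $\mathcal{A}$ is a $\frac12$-derivation if $d(xy)=\frac12\big(d(x)y+x\,d(y)\big)$ for all $x,y\in\mathcal{A}$. A linear map $D:\mathcal{A}\to\mathcal{A}$ is a local $\frac12$-derivation if for every $x\in\mathcal{A}$ there exists a $\frac12$-derivation $d_x$ of $\mathcal{A}$ such that $D(x)=d_x(x)$. *)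

(* Defs.v *)
From HB Require Import structures.
From mathcomp Require Import all_boot all_algebra.

Set Implicit Arguments.
Unset Strict Implicit.
Unset Printing Implicit Defensive.

Import GRing.Theory.
Local Open Scope ring_scope.

Definition half_derivation (K : fieldType) (A : lmodType K)
    (mul : {bilinear A -> A -> A}) (d : {linear A -> A}) : Prop :=
  forall x y : A, d (mul x y) = 2^-1 *: (mul (d x) y + mul x (d y)).

Definition local_half_derivation (K : fieldType) (A : lmodType K)
    (mul : {bilinear A -> A -> A}) (D : {linear A -> A}) : Prop :=
  forall x : A, exists2 dx : {linear A -> A},
    half_derivation mul dx & D x = dx x.

Section S2.

Variable K : fieldType.

(* The basis vector z_k, meaningful for 1 <= k <= 4: vector entries are indexed
   from 0. *)
Definition S2_z (k : nat) : 'rV[K]_4 := delta_mx 0 (inord k.-1).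

(* The product z_i z_j (cf. S2_mul_z): the multiplication table of the algebra of
   all commutative 2-dimensional algebras with trace zero multiplication. *)
Definition S2_table (i j : nat) : 'rV[K]_4 :=
  match i, j with
  | 1, 1 => - S2_z 1
  | 1, 2 => S2_z 2
  | 1, 3 => 3 *: S2_z 3
  | 1, 4 => - 3 *: S2_z 4
  | 2, 1 => - 2 *: S2_z 2
  | 2, 2 => - 3 *: S2_z 3
  | 2, 4 => S2_z 1
  | 4, 1 => 3 *: S2_z 4
  | 4, 2 => - 2 *: S2_z 1
  | 4, 3 => - S2_z 2
  | _, _ => 0
  end.

Definition S2_mul (x y : 'rV[K]_4) : 'rV[K]_4 :=
  \sum_(i < 4) \sum_(j < 4) (x 0 i * y 0 j) *: S2_table i.+1 j.+1.

Fact S2_mul_is_bilinear : bilinear_for *:%R *:%R S2_mul.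
Proof.
split=> [y a x x' | x a y y']; rewrite /S2_mul /=.
  rewrite scaler_sumr -big_split; apply: eq_bigr => i _ /=.
  rewrite scaler_sumr -big_split; apply: eq_bigr => j _ /=.
  by rewrite !mxE mulrDl scalerDl scalerA mulrA.
rewrite scaler_sumr -big_split; apply: eq_bigr => i _ /=.
rewrite scaler_sumr -big_split; apply: eq_bigr => j _ /=.
by rewrite !mxE mulrDr scalerDl scalerA mulrCA.
Qed.

HB.instance Definition _ :=
  bilinear_isBilinear.Build K 'rV[K]_4 'rV[K]_4 'rV[K]_4 *:%R *:%R S2_mul
    S2_mul_is_bilinear.

Lemma S2_mul_z (i j : nat) :
  (0 < i <= 4)%N -> (0 < j <= 4)%N -> S2_mul (S2_z i) (S2_z j) = S2_table i j.
Proof.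
case: i => // i; case: j => // j; rewrite /= => i_lt4 j_lt4; rewrite /S2_mul.
rewrite (bigD1 (inord i)) //= [X in _ + X]big1 ?addr0; last first.
  move=> k /negPf ne_k; apply: big1 => l _.
  by rewrite /S2_z !mxE ne_k andbF mul0r scale0r.
rewrite (bigD1 (inord j)) //= [X in _ + X]big1 ?addr0; last first.
  by move=> l /negPf ne_l; rewrite /S2_z !mxE ne_l andbF mulr0 scale0r.
by rewrite /S2_z !mxE !eqxx mulr1 scale1r !inordK.
Qed.

End S2.

(* Main.v *)
Require Import Defs.
From mathcomp Require Import all_boot all_algebra.
From mathcomp Require Import ring.

(** Every 1/2-derivation of S_2 is a scalar multiple of the identity
    ([S2_half_derivation_scalar]), so a local 1/2-derivation sends each vector
    to a multiple of itself.  A linear map with this property is a homothety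
    ([linear_pointwise_scalar]), and homotheties are 1/2-derivations
    ([half_derivation_scale]).

    The 1/2-derivations of S_2 are scalar because the left and right
    multiplications by z_1 are both diagonal in the basis z_1, ..., z_4, with
    weights (-1, 1, 3, -3) and (-1, -2, 0, 3).  Applying a 1/2-derivation d to
    z_1 z_1 = - z_1 shows that d(z_1) is killed by L + R + 2, where L and R are
    these two multiplications; L + R has weight -2 on z_1 only, so
    d(z_1) = a z_1.  Then e = d - a id satisfies 2 e(z_1 y) = z_1 e(y): it maps
    vectors of L-weight l to vectors of L-weight 2 l.  No weight of L is twice
    a weight of L, hence e = 0.  Characteristic zero serves to keep these
    finitely many integer disequalities true in the field. *)

Set Implicit Arguments.
Unset Strict Implicit.
Unset Printing Implicit Defensive.

Import GRing.Theory.
Local Open Scope ring_scope.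

Lemma pchar0_intr_eq0 (K : fieldType) (charK0 : [pchar K] =i pred0) (m : int) :
  (m%:~R == 0 :> K) = (m == 0).
Proof.
have natr0 n : (n%:R == 0 :> K) = (n == 0%N) by move/pcharf0P: charK0 => ->.
by case: m => n; rewrite ?NegzE ?rmorphN ?oppr_eq0 /= -pmulrn natr0.
Qed.

Lemma half_derivation_scale (K : fieldType) (A : lmodType K)
    (mul : {bilinear A -> A -> A}) (d : {linear A -> A}) (c : K) :
  2 != 0 :> K -> (forall x, d x = c *: x) -> half_derivation mul d.
Proof.
move=> nz2 dE x y; rewrite !dE linearZl_LR linearZr_LR -mulr2n.
by rewrite -scaler_nat scalerA mulVf // scale1r.
Qed.

Lemma linear_diagonal_coord (K : fieldType) (n : nat)
    (f : {linear 'rV[K]_n -> 'rV[K]_n}) (w : 'I_n -> K) :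
  (forall j, f (delta_mx 0 j) = w j *: delta_mx 0 j) ->
  forall x k, f x 0 k = w k * x 0 k.
Proof.
move=> fE x k; rewrite {1}[x]row_sum_delta linear_sum summxE (bigD1 k) //=.
rewrite big1 => [|j ne_jk]; rewrite linearZ fE !mxE !eqxx.
  by rewrite addr0 mulr1 mulrC.
by rewrite eq_sym (negPf ne_jk) !mulr0.
Qed.

(** The scalar is read off at the sum of the basis vectors: there the image of
    each basis vector contributes exactly one coordinate, so all basis vectors
    have the same eigenvalue. *)
Lemma linear_pointwise_scalar (K : fieldType) (n : nat)
    (D : {linear 'rV[K]_n -> 'rV[K]_n}) :
  (forall x, exists c : K, D x = c *: x) ->
  exists c : K, forall x, D x = c *: x.
Proof.
move=> Dscal; pose w j := D (delta_mx 0 j) 0 j.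
have Dcoord := @linear_diagonal_coord K n D w.
have [c Dc] := Dscal (const_mx 1); exists c => x.
have {}Dcoord y k : D y 0 k = w k * y 0 k.
  apply: Dcoord => j; rewrite /w; have [b ->] := Dscal (delta_mx 0 j).
  by rewrite !mxE !eqxx mulr1.
apply/rowP=> k; have := congr1 (fun u : 'rV[K]_n => u 0 k) Dc.
by rewrite !Dcoord !mxE !mulr1 => ->.
Qed.

Definition S2_left_weight (j : 'I_4) : int := nth 0 [:: -1; 1; 3; -3] j.
Definition S2_right_weight (j : 'I_4) : int := nth 0 [:: -1; -2; 0; 3] j.

Section ScalarHalfDerivations.

Variable K : fieldType.

Lemma S2_zE (j : 'I_4) : S2_z K j.+1 = delta_mx 0 j.
Proof. by rewrite /S2_z /= inord_val. Qed.

Lemma S2_mul_z1l (j : 'I_4) :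
  S2_mul (S2_z K 1) (delta_mx 0 j) = (S2_left_weight j)%:~R *: delta_mx 0 j.
Proof.
rewrite -S2_zE S2_mul_z ?ltn_ord //.
by case: j => [[|[|[|[|j]]]] ltj4] //=;
  rewrite /S2_left_weight /= ?scale1r ?rmorphN ?scaleN1r.
Qed.

Lemma S2_mul_z1r (j : 'I_4) :
  S2_mul (delta_mx 0 j) (S2_z K 1) = (S2_right_weight j)%:~R *: delta_mx 0 j.
Proof.
rewrite -S2_zE S2_mul_z ?ltn_ord //.
by case: j => [[|[|[|[|j]]]] ltj4] //=;
  rewrite /S2_right_weight /= ?scale0r ?rmorphN ?scaleN1r.
Qed.

(** The product packed as a bilinear map, so that its partial applications are
    inferred to be linear. *)
Let mulS2 : {bilinear 'rV[K]_4 -> 'rV[K]_4 -> 'rV[K]_4} := @S2_mul K.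

Lemma S2_mul_z1l_coord (x : 'rV[K]_4) k :
  S2_mul (S2_z K 1) x 0 k = (S2_left_weight k)%:~R * x 0 k.
Proof.
exact: (@linear_diagonal_coord K 4 (mulS2 (S2_z K 1)) _ S2_mul_z1l).
Qed.

Lemma S2_mul_z1r_coord (x : 'rV[K]_4) k :
  S2_mul x (S2_z K 1) 0 k = (S2_right_weight k)%:~R * x 0 k.
Proof.
exact: (@linear_diagonal_coord K 4 (applyr mulS2 (S2_z K 1)) _ S2_mul_z1r).
Qed.

Hypothesis charK0 : [pchar K] =i pred0.

Lemma pchar0_two_neq0 : 2 != 0 :> K.
Proof. exact: etrans (congr1 negb (pchar0_intr_eq0 charK0 2)) _. Qed.

Lemma half_derivation_double (A : lmodType K) (mul : {bilinear A -> A -> A})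
    (d : {linear A -> A}) (x y : A) :
  half_derivation mul d -> 2 *: d (mul x y) = mul (d x) y + mul x (d y).
Proof. by move->; rewrite scalerA divff ?scale1r ?pchar0_two_neq0. Qed.

Variable d : {linear 'rV[K]_4 -> 'rV[K]_4}.
Hypothesis d_half : half_derivation (@S2_mul K) d.

Lemma S2_half_derivation_z1 : d (S2_z K 1) = d (S2_z K 1) 0 0 *: S2_z K 1.
Proof.
(* By (L + R + 2) d(z_1) = 0, each coordinate of d(z_1) but the first, whose
   weight is -2, has a nonzero factor. *)
apply/rowP=> k; rewrite !mxE [inord _](_ : _ = 0) /=; last first.
  exact: (inord_val 0).
have [->|nz_k] := eqVneq k 0; first by rewrite mulr1.
rewrite mulr0; apply/eqP.
have := half_derivation_double (S2_z K 1) (S2_z K 1) d_half.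
rewrite /= S2_mul_z //= linearN => /rowP/(_ k).
rewrite [RHS]mxE S2_mul_z1l_coord S2_mul_z1r_coord !mxE -mulrDl mulrN -mulNr.
move/eqP; rewrite -subr_eq0 -mulrBl mulf_eq0 => /orP[|//].
rewrite -(intrD K) -[2]/(2%:~R) -(rmorphN intr) -(rmorphB intr).
rewrite pchar0_intr_eq0 //.
by case: k nz_k => [[|[|[|[|k]]]] ltk4].
Qed.

(** Once d(z_1) = a z_1, comparing the coordinates of 2 d(z_1 z_j) and
    a z_1 z_j + z_1 d(z_j) gives (2 l_j - l_k) e_jk = 0 for the entries e_jk of
    d - a id, where l_j are the left weights; no l_k equals 2 l_j. *)
Lemma S2_half_derivation_scalar : exists c : K, forall x, d x = c *: x.
Proof.
exists (d (S2_z K 1) 0 0) => x; set a := d _ 0 0.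
have dzE j : d (delta_mx 0 j) = a *: delta_mx 0 j.
  apply/rowP=> k; apply/eqP; rewrite -subr_eq0.
  have := half_derivation_double (S2_z K 1) (delta_mx 0 j) d_half.
  rewrite /= S2_half_derivation_z1 -/a linearZl_LR /=.
  rewrite S2_mul_z1l linearZ => /rowP/(_ k).
  rewrite [RHS]mxE S2_mul_z1l_coord !mxE eqxx /=.
  set lj := S2_left_weight j; set lk := S2_left_weight k; set u := d _ 0 k.
  move=> Eu; have: (2 * lj - lk)%:~R * (u - a * (k == j)%:R) == 0.
    have Edelta : lk%:~R * (k == j)%:R = lj%:~R * (k == j)%:R :> K.
      by rewrite /lk; case: eqVneq => [->|_]; rewrite ?mulr0.
    have -> : (2 * lj - lk)%:~R * (u - a * (k == j)%:R) =
        2 * (lj%:~R * u) - (a * (lj%:~R * (k == j)%:R) + lk%:~R * u)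
        + a * (lk%:~R * (k == j)%:R - lj%:~R * (k == j)%:R).
      by rewrite rmorphB rmorphM /=; ring.
    by rewrite Eu Edelta !subrr mulr0 addr0.
  rewrite mulf_eq0 pchar0_intr_eq0 // => /orP[|//].
  (* 2 * lj = lk is refuted by computation on the sixteen pairs of weights. *)
  rewrite /lj /lk.
  by case: (j) => [[|[|[|[|?]]]] ?] //; case: (k) => [[|[|[|[|?]]]] ?].
apply/rowP=> k; rewrite mxE.
exact: (@linear_diagonal_coord K 4 d (fun=> a) dzE).
Qed.

End ScalarHalfDerivations.

Theorem theorem3p2 (K : fieldType) (charK0 : [pchar K] =i pred0)
    (D : {linear 'rV[K]_4 -> 'rV[K]_4}) :
  local_half_derivation (@S2_mul K) D -> half_derivation (@S2_mul K) D.
Proof.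
move=> D_local; have [x|c DE] := @linear_pointwise_scalar K 4 D.
  have [dx dx_half ->] := D_local x.
  by have [c ->] := S2_half_derivation_scalar charK0 dx_half; exists c.
exact: half_derivation_scale (pchar0_two_neq0 charK0) DE.
Qed.
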